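(* Let a connected graph of $m$ springs on $n$ nodes with matrix $D$, two distinct loading nodes $\Phi,\Psi$ and incidence vector $R$ be given as in the context. Let $\xi\in\mathbb{R}^n$ be an arbitrary vector of coordinates of the nodes such that $\xi_i\neq\xi_\Phi$ for all $i\neq\Phi$, $\xi_i\neq\xi_\Psi$ for all $i\neq\Psi$, and $\xi_\Phi<\xi_\Psi$. Consider the following transformation of a coordinate vector $\xi$: pick any two adjacent nodes $i$ and $j$ such that $\xi_i\notin\{\xi_\Phi,\xi_\Psi\}$ and $\xi_j\in\{\xi_\Phi,\xi_\Psi\}$, and put $\xi_i:=\xi_j$ (leaving all other components unchanged). Suppose that a finite sequence of such transformations brings the original $\xi$ to a new vector, again denoted by $\xi$, that satisfies $\xi_i\in\{\xi_\Phi,\xi_\Psi\}$ for every $i\in\{1,\dots,n\}$. Then: 1. The new $\xi$ has the following property: for every $i\in\{1,\dots,n\}$, if $\xi_i=\xi_\Phi$ and $i\neq\Phi$, then there exists an $(i\Phi)$-walk all of whose nodes $j$ satisfy $\xi_j=\xi_\Phi$; and, likewise, if $\xi_i=\xi_\Psi$ and $i\neq\Psi$, then there exists an $(i\Psi)$-walk all of whose nodes $j$ satisfy $\xi_j=\xi_\Psi$. 2. Let $\{j_1,\dots,j_s\}$ be the set of all indices $j\in\{1,\dots,m\}$ such that $[D\xi]_j\neq 0$ for the new $\xi$, and let $\alpha_{j_k}=\operatorname{sign}([D\xi]_{j_k})$, $k=1,\dots,s$. Then $I_0=\{(\alpha_{j_1},j_1),\dots,(\alpha_{j_s},j_s)\}$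 is admissible and irreducible.
   Context: Setting. A directed graph has $n$ nodes $1,\dots,n$ and $m$ edges (called springs) $1,\dots,m$; the graph is connected (ignoring orientations). The $m\times n$ matrix $D$ is defined as follows: the $(i,j)$-element of $D^T$ is $1$ if node $i$ is the terminus of spring $j$, $-1$ if node $i$ is the source of spring $j$, and $0$ otherwise. Thus for a coordinate vector $\xi\in\mathbb{R}^n$, the $j$-th component $[D\xi]_j$ (the length of spring $j$) is the coordinate of the terminus of spring $j$ minus the coordinate of its source. Since the graph is connected, $\operatorname{rank} D=n-1$, and $D^\perp$ denotes a fixed $m\times(m-n+1)$ matrix with $(D^\perp)^TD=0$ and $\operatorname{rank}(D^\perp)=m-n+1$. Two distinct nodes $\Phi,\Psi$ (the endpoints of the displacement-controlled loading) are fixed, and $R\in\mathbb{R}^m$ is the incidence vector of a fixed path of springs from $\Phi$ to $\Psi$: its $j$-th component is $0$ if spring $j$ is not in the path, $1$ if the path (followed from $\Phi$ to $\Psi$) traverses spring $j$ from source to terminus, and $-1$ if it traverses spring $j$ from terminus to source. Hence $R^TD\xi=\xi_\Psi-\xi_\Phi$ for all $\xi\in\mathbb{R}^n$. Walks. Two nodes are adjacent if they are connected by a spring (in either direction). An $(i_1i_q)$-walk is a sequence of nodes $i_1,\dots,i_q$ such that $i_t$ and $i_{t+1}$ are adjacent for every $t\in\{1,\dots,q-1\}$. Admissibility and irreducibility. Let $e_j$ be the $j$-th standard basis vector of $\mathbb{R}^m$. A set $I_0\subset\{-1,1\}\times\{1,\dots,m\}$ is admissible if there is $c_1>0$ such that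 $$\begin{pmatrix} c_1\\ 0_{m-n+1}\end{pmatrix}\in\operatorname{cone}\left(\begin{pmatrix} R^T\\ (D^\perp)^T\end{pmatrix}\{\alpha e_j:(\alpha,j)\in I_0\}\right),$$ where $\operatorname{cone}$ denotes the set of all linear combinations with nonnegative coefficients (so the cone of the empty set is $\{0\}$). An admissible $I_0$ is irreducible if no $\tilde I_0\subset I_0$ with $\tilde I_0\neq I_0$ is admissible. *)

(* Defs.v *)
From mathcomp Require Import all_boot all_order all_algebra.
From mathcomp Require Import reals.

Set Implicit Arguments.
Unset Strict Implicit.
Unset Printing Implicit Defensive.

Import Order.TTheory GRing.Theory Num.Theory.
Local Open Scope ring_scope.

(* Multiple springs between the same nodes are allowed. *)
Record spring_graph (n m : nat) := SpringGraph {
  source : 'I_m -> 'I_n;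
  terminus : 'I_m -> 'I_n
}.

Section Graph.
Variables (n m : nat) (G : spring_graph n m).

Definition adjacent : rel 'I_n := fun a b =>
  [exists j, ((source G j == a) && (terminus G j == b))
          || ((source G j == b) && (terminus G j == a))].

Definition connected_graph : Prop := forall a b, connect adjacent a b.

(* A pair (b, j) is spring j traversed from source to terminus if b = true, *)
(* and from terminus to source if b = false.                                *)
Definition step_start (e : bool * 'I_m) : 'I_n :=
  if e.1 then source G e.2 else terminus G e.2.

Definition step_end (e : bool * 'I_m) : 'I_n :=
  if e.1 then terminus G e.2 else source G e.2.

Fixpoint traverses (a b : 'I_n) (p : seq (bool * 'I_m)) : bool :=
  if p is e :: q then (step_start e == a) && traverses (step_end e) b q
  else a == b.

(* Each spring is used at most once, which is what makes the incidence      *)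
(* vector well defined; paths without repeated nodes are a special case.    *)
Definition spring_path (a b : 'I_n) (p : seq (bool * 'I_m)) : bool :=
  traverses a b p && uniq [seq e.2 | e <- p].

(* The row of a spring with distinct ends is 1 at the terminus, -1 at the   *)
(* source and 0 elsewhere; a loop, if there is one, gets a zero row.        *)
Definition Dmx (R : realType) : 'M[R]_(m, n) :=
  \matrix_(j, i) ((i == terminus G j)%:R - (i == source G j)%:R).

Definition transformation (R : realType) (Phi Psi : 'I_n) : rel 'cV[R]_n :=
  fun xi xi' =>
  [exists i, exists j,
    [&& adjacent i j,
        xi i 0 \notin [:: xi Phi 0; xi Psi 0],
        xi j 0 \in [:: xi Phi 0; xi Psi 0] &
        xi' == \col_k (if k == i then xi j 0 else xi k 0)]].

End Graph.

Definition incidence (R : realType) (m : nat) (p : seq (bool * 'I_m)) :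
    'cV[R]_m :=
  \col_j (if (true, j) \in p then 1 else if (false, j) \in p then -1 else 0).

(* The set {-1, 1} is encoded by bool; beware that this is opposite to the  *)
(* convention (-1) ^+ b.                                                    *)
Definition sign_val (R : realType) (b : bool) : R := if b then 1 else -1.

(* v is in the cone generated by the vectors f i, i \in A. *)
Definition in_cone (R : realType) (k : nat) (I : finType) (A : {set I})
    (f : I -> 'cV[R]_k) (v : 'cV[R]_k) : Prop :=
  exists c : I -> R,
    (forall i, i \in A -> 0 <= c i) /\ v = \sum_(i in A) c i *: f i.

Definition admissible (R : realType) (m d : nat) (Rvec : 'cV[R]_m)
    (Dperp : 'M[R]_(m, d)) (I0 : {set bool * 'I_m}) : Prop :=
  exists c1 : R, 0 < c1 /\
    in_cone I0
      (fun p => col_mx Rvec^T Dperp^T *m (sign_val R p.1 *: delta_mx p.2 0))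
      (col_mx c1%:M 0).

Definition irreducible (R : realType) (m d : nat) (Rvec : 'cV[R]_m)
    (Dperp : 'M[R]_(m, d)) (I0 : {set bool * 'I_m}) : Prop :=
  admissible Rvec Dperp I0 /\
  forall J : {set bool * 'I_m},
    J \subset I0 -> J <> I0 -> ~ admissible Rvec Dperp J.

Definition sign_set (R : realType) (m : nat) (v : 'cV[R]_m) :
    {set bool * 'I_m} :=
  [set p | (v p.2 0 != 0) && (sign_val R p.1 == Num.sg (v p.2 0))].

(* Main.v *)
(* The final vector takes two values, and its two level sets are connected,
   because every moved node is attached to a node that is already joined to
   [Phi] (or [Psi]) inside its level set. Since the kernel of [Dperp^T] is the
   column space of [D], admissibility of [J] means that some [D eta], with
   [eta Phi < eta Psi], is supported on [J] with the prescribed signs. For [J]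
   the sign set of the final vector one takes [eta] to be that vector. If [J] is
   an admissible subset of it, then [eta] is constant on both level sets, so
   that [D eta] is nonzero on every spring joining them, and [J] is the whole
   sign set. *)
Require Import Defs.
From mathcomp Require Import all_boot all_order all_algebra.
From mathcomp Require Import reals.

Set Implicit Arguments.
Unset Strict Implicit.
Unset Printing Implicit Defensive.

Import Order.TTheory GRing.Theory Num.Theory.
Local Open Scope ring_scope.

(** * Kernel and rank of the matrix [D] *)

Lemma mul_Dmx (R : realType) (n m : nat) (G : spring_graph n m)
    (xi : 'cV[R]_n) (j : 'I_m) :
  (Dmx G R *m xi) j 0 = xi (terminus G j) 0 - xi (source G j) 0.
Proof.
rewrite mxE.
under eq_bigr do rewrite mxE mulrBl !mulr_natl !mulrb.
by rewrite sumrB -!big_mkcond !big_pred1_eq.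
Qed.

Lemma mul_Dmx_eq0 (R : realType) (n m : nat) (G : spring_graph n m)
    (xi : 'cV[R]_n) (a b : 'I_n) :
  adjacent G a b ->
  (forall j, source G j \in [:: a; b] -> terminus G j \in [:: a; b] ->
     (Dmx G R *m xi) j 0 = 0) ->
  xi a 0 = xi b 0.
Proof.
move=> /existsP[j /orP[]/andP[/eqP sj /eqP tj]] /(_ j);
  rewrite sj tj !inE !eqxx ?orbT mul_Dmx sj tj => /(_ isT isT) /eqP;
  by rewrite subr_eq0 => /eqP.
Qed.

(** Consecutive nodes of the walk have equal coordinates. Only springs with both ends on the walk
    are constrained, so the lemma serves both for the kernel of [D] and inside a single level
    set. *)
Lemma walk_const (R : realType) (n m : nat) (G : spring_graph n m)
    (xi : 'cV[R]_n) (i : 'I_n) (w : seq 'I_n) :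
  path (adjacent G) i w ->
  (forall j, source G j \in i :: w -> terminus G j \in i :: w ->
     (Dmx G R *m xi) j 0 = 0) ->
  xi i 0 = xi (last i w) 0.
Proof.
elim: w i => [//|k w IHw] i /= /andP[ik kw] Dxi0.
have sub_kw : {subset k :: w <= i :: k :: w}.
  by move=> l lw; rewrite inE lw orbT.
rewrite -IHw //; last by move=> j /sub_kw sj /sub_kw tj; exact: Dxi0.
apply: mul_Dmx_eq0 ik _ => j sj tj; apply: Dxi0.
  by move: sj; rewrite !inE => /orP[]->; rewrite ?orbT.
by move: tj; rewrite !inE => /orP[]->; rewrite ?orbT.
Qed.

(** A vector killed by [D] is constant along every walk, hence on the whole connected graph, so the
    kernel has dimension at most one. *)
Lemma rank_Dmx (R : realType) (n m : nat) (G : spring_graph n m) :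
  connected_graph G -> (n <= (\rank (Dmx G R)).+1)%N.
Proof.
move=> Gconn; have ker_const : (kermx (Dmx G R)^T <= (const_mx 1 : 'rV[R]_n))%MS.
  apply/row_subP => k; set x := row k _.
  have xD0 : Dmx G R *m x^T = 0.
    by apply: trmx_inj; rewrite trmx_mul trmxK trmx0; apply/sub_kermxP/row_sub.
  (* Every coordinate of the constant vector [x] is a valid scalar; [k] is an index already at
     hand. *)
  apply/sub_rVP; exists (x 0 k); apply/rowP => i; rewrite [RHS]mxE [X in _ * X]mxE mulr1.
  have /connectP[w iw wk] := Gconn i k.
  have := walk_const (xi := x^T) iw; rewrite -wk !mxE; apply=> j _ _.
  by rewrite xD0 mxE.
have := leq_trans (mxrankS ker_const) (rank_leq_row _).
by rewrite mxrank_ker mxrank_tr leq_subLR addn1.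
Qed.

(** Orthogonality puts the column space of [D] inside the kernel of [Dperp^T], and the ranks leave
    no room for a larger kernel. The argument runs on transposes because [kermx] and matrix
    inclusion concern row spaces. *)
Lemma ker_Dperp (R : realType) (n m : nat) (G : spring_graph n m)
    (Dperp : 'M[R]_(m, m.+1 - n)) (v : 'cV[R]_m) :
  connected_graph G -> Dperp^T *m Dmx G R = 0 ->
  \rank Dperp = (m.+1 - n)%N -> Dperp^T *m v = 0 ->
  exists eta : 'cV[R]_n, v = Dmx G R *m eta.
Proof.
move=> Gconn DpD rkDp Dpv.
have rkD := rank_Dmx R Gconn.
have D_sub : ((Dmx G R)^T <= kermx Dperp)%MS.
  by apply/sub_kermxP/trmx_inj; rewrite trmx_mul trmxK trmx0.
(* This bound makes the truncated difference [m.+1 - n] exact in the rank count below. *)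
have n_le : (n <= m.+1)%N by apply: leq_trans rkD _; rewrite ltnS rank_leq_row.
have ker_sub : (kermx Dperp <= (Dmx G R)^T)%MS.
  rewrite -(geq_leqif (mxrank_leqif_sup D_sub)) mxrank_ker rkDp mxrank_tr.
  rewrite leq_subLR -ltnS -addnS.
  by rewrite -{1}(subnK n_le) leq_add2l.
have /submxP[y vy] : (v^T <= (Dmx G R)^T)%MS.
  apply: submx_trans ker_sub; apply/sub_kermxP/trmx_inj.
  by rewrite trmx_mul trmxK trmx0.
by exists y^T; apply: trmx_inj; rewrite vy trmx_mul trmxK.
Qed.

(** * Incidence vector of a path *)

Lemma incidence_cons (R : realType) (m : nat) (e : bool * 'I_m)
    (p : seq (bool * 'I_m)) :
  e.2 \notin [seq f.2 | f <- p] ->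
  incidence R (e :: p) = sign_val R e.1 *: delta_mx e.2 0 + incidence R p.
Proof.
case: e => b j /= jp; apply/colP => k; rewrite !mxE !inE !xpair_eqE eqxx andbT.
have [->|kj] := eqVneq k j; last by rewrite !andbF mulr0 add0r.
have notp c : (c, j) \in p = false.
  by apply: contraNF jp => cjp; apply/mapP; exists (c, j).
by rewrite !notp !andbT !orbF addr0 mulr1; case: b.
Qed.

(** Telescoping: each spring contributes the coordinate of its [step_end] minus that of its
    [step_start], whichever way it is traversed. *)
Lemma mul_incidence_Dmx (R : realType) (n m : nat) (G : spring_graph n m)
    (a b : 'I_n) (p : seq (bool * 'I_m)) (xi : 'cV[R]_n) :
  spring_path G a b p ->
  ((incidence R p)^T *m (Dmx G R *m xi)) 0 0 = xi b 0 - xi a 0.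
Proof.
rewrite /spring_path; elim: p a => [|e p IHp] a /=.
  move=> /andP[/eqP-> _]; rewrite subrr mxE big1 // => j _.
  by rewrite !mxE mul0r.
move=> /andP[/andP[/eqP<- ebp] /andP[ep up]].
rewrite incidence_cons // linearD linearZ /= trmx_delta mulmxDl -scalemxAl.
rewrite -rowE mxE (IHp (step_end G e)) ?ebp // [X in X + _]mxE.
rewrite [X in _ * X + _]mxE mul_Dmx.
by rewrite /step_start /step_end /sign_val; case: (e.1);
  rewrite ?mulN1r ?mul1r ?opprB addrC addrA subrK.
Qed.

(** * Signed sums, admissibility and sign sets *)

Definition signed_sum (R : realType) (m : nat) (I : {set bool * 'I_m})
    (c : bool * 'I_m -> R) : 'cV[R]_m :=
  \sum_(q in I) c q *: (sign_val R q.1 *: delta_mx q.2 0).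

(** The stacked matrix moves outside the conic combination and its two blocks separate; [c1] is then
    the value of the upper block. *)
Lemma admissibleP (R : realType) (m d : nat) (r : 'cV[R]_m)
    (Dperp : 'M[R]_(m, d)) (I : {set bool * 'I_m}) :
  admissible r Dperp I <->
  exists c, [/\ forall q, q \in I -> 0 <= c q,
    0 < (r^T *m signed_sum I c) 0 0 & Dperp^T *m signed_sum I c = 0].
Proof.
have coneE (c : bool * 'I_m -> R) : \sum_(q in I) c q *:
    (col_mx r^T Dperp^T *m (sign_val R q.1 *: delta_mx q.2 0)) =
    col_mx (r^T *m signed_sum I c) (Dperp^T *m signed_sum I c).
  rewrite -mul_col_mx mulmx_sumr; apply: eq_bigr => q _.
  by rewrite -!scalemxAr.
split=> [[c1 [c1_gt0 [c [c_ge0]]]]|[c [c_ge0 c1_gt0 Dc0]]].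
  rewrite coneE => /eq_col_mx[rc Dc]; exists c; split=> //.
  by rewrite -rc mxE eqxx.
exists ((r^T *m signed_sum I c) 0 0); split=> //; exists c; split=> //.
by rewrite coneE Dc0 -mx11_scalar.
Qed.

Lemma signed_sum_notin (R : realType) (m : nat) (I : {set bool * 'I_m})
    (c : bool * 'I_m -> R) (j : 'I_m) :
  (forall b, (b, j) \notin I) -> signed_sum I c j 0 = 0.
Proof.
move=> jI; rewrite summxE big1 // => -[b k] bkI; rewrite !mxE /= andbT.
have [jk|_] := eqVneq j k; last by rewrite !mulr0.
by move: bkI; rewrite -jk (negPf (jI b)).
Qed.

Lemma sign_val_eq_sg (R : realType) (b : bool) (x : R) :
  x != 0 -> (sign_val R b == Num.sg x) = (b == (0 < x)).
Proof.
rewrite /sign_val => x_neq0; case: (ltrgt0P x) x_neq0 => // [x_gt0|x_lt0] _.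
  by rewrite gtr0_sg //; case: b; rewrite ?eqxx // eqNr oner_eq0.
by rewrite ltr0_sg //; case: b; rewrite ?eqxx // eq_sym eqNr oner_eq0.
Qed.

Lemma in_sign_set (R : realType) (m : nat) (v : 'cV[R]_m) (b : bool) (j : 'I_m) :
  ((b, j) \in sign_set v) = (v j 0 != 0) && (b == (0 < v j 0)).
Proof.
by rewrite inE /=; have [//|/= vj] := eqVneq (v j 0) 0; rewrite sign_val_eq_sg.
Qed.

(** Coordinatewise, a number is its sign times its absolute value. This supplies the cone
    coefficients for the admissibility of a sign set. *)
Lemma signed_sum_sign_set (R : realType) (m : nat) (v : 'cV[R]_m) :
  signed_sum (sign_set v) (fun q => `|v q.2 0|) = v.
Proof.
apply/colP => j; have [vj0|vj0] := eqVneq (v j 0) 0.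
  rewrite vj0; apply: signed_sum_notin => b.
  by rewrite in_sign_set vj0 eqxx.
(* A sign set has at most one pair over each spring, so this pair alone contributes at [j]. *)
rewrite summxE (bigD1 (0 < v j 0, j)) /=; last by rewrite in_sign_set vj0 eqxx.
rewrite big1 => [|[b k] /andP[]]; last first.
  rewrite in_sign_set xpair_eqE /= !mxE => /andP[_ bk].
  have [->|_] := eqVneq j k; last by rewrite !mulr0.
  by rewrite eqxx bk.
rewrite !mxE !eqxx mulr1 addr0 /sign_val.
by case: ltrgt0P vj0; rewrite ?mulr1 ?mulrN1 ?opprK.
Qed.

(** * Connectedness of level sets under transformations *)

(** The case [i = Z] is included, with the empty walk, so that a moved node can be prepended to the
    walk of its neighbour even when that neighbour is [Z]. *)
Definition level_walks (R : realType) (n m : nat) (G : spring_graph n m)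
    (Z : 'I_n) (xi : 'cV[R]_n) : Prop :=
  forall i, xi i 0 = xi Z 0 -> exists w : seq 'I_n,
    [/\ path (adjacent G) i w, last i w = Z &
        forall j, j \in i :: w -> xi j 0 = xi Z 0].

Lemma transformation_fix (R : realType) (n m : nat) (G : spring_graph n m)
    (Phi Psi Z : 'I_n) (xi xi' : 'cV[R]_n) :
  Z \in [:: Phi; Psi] -> transformation G Phi Psi xi xi' -> xi' Z 0 = xi Z 0.
Proof.
move=> ZPP /existsP[i /existsP[j /and4P[_ xi_i _ /eqP->]]].
rewrite mxE; case: eqVneq => // Zi; move: xi_i ZPP; rewrite -Zi !inE.
by move=> /norP[ZPhi ZPsi] /orP[]/eqP ZE; move: ZPhi ZPsi; rewrite ZE eqxx.
Qed.

Lemma transformation_level_walks (R : realType) (n m : nat)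
    (G : spring_graph n m) (Phi Psi Z : 'I_n) (xi xi' : 'cV[R]_n) :
  Z \in [:: Phi; Psi] -> transformation G Phi Psi xi xi' ->
  level_walks G Z xi -> level_walks G Z xi'.
Proof.
move=> ZPP xi_xi' walks k; rewrite (transformation_fix ZPP xi_xi').
case/existsP: xi_xi' => i /existsP[j /and4P[ij xi_i _ /eqP xi'E]].
have xi_iZ : xi i 0 <> xi Z 0.
  by move: xi_i; rewrite !inE => /norP[/eqP ? /eqP ?];
    move: ZPP; rewrite !inE => /orP[]/eqP->.
(* The moved node [i] lies off the level of [Z], so nodes on that level keep their value and old
   walks survive. *)
have keep (l : 'I_n) : xi l 0 = xi Z 0 -> xi' l 0 = xi Z 0.
  by move=> lZ; rewrite xi'E mxE; case: eqVneq => // li; rewrite -li in xi_iZ.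
(* Either [k] is the moved node and is prepended to the walk of [j], or it keeps its own walk. *)
rewrite {1}xi'E mxE; case: eqVneq => [->|_] kZ; have [w [kw wZ wxi]] := walks _ kZ.
  exists (j :: w); split=> //=; first by rewrite ij.
  move=> l; rewrite inE => /predU1P[->|/wxi/keep//].
  by rewrite xi'E mxE eqxx.
by exists w; split=> // l /wxi/keep.
Qed.

Lemma level_walks_last (R : realType) (n m : nat) (G : spring_graph n m)
    (Phi Psi Z : 'I_n) (xi : 'cV[R]_n) (s : seq 'cV[R]_n) :
  Z \in [:: Phi; Psi] -> path (transformation G Phi Psi) xi s ->
  level_walks G Z xi ->
  last xi s Z 0 = xi Z 0 /\ level_walks G Z (last xi s).
Proof.
move=> ZPP; elim: s xi => //= xi1 s IHs xi /andP[xi_xi1 /IHs IH] walks.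
rewrite -(transformation_fix ZPP xi_xi1).
exact: IH (transformation_level_walks ZPP xi_xi1 walks).
Qed.

(** A spring inside the level set has zero length under [xi], hence under [eta], so [eta] is
    constant along the walk to [Z]. *)
Lemma level_walks_const (R : realType) (n m : nat) (G : spring_graph n m)
    (Z : 'I_n) (xi eta : 'cV[R]_n) :
  level_walks G Z xi ->
  (forall j, (Dmx G R *m xi) j 0 = 0 -> (Dmx G R *m eta) j 0 = 0) ->
  forall i, xi i 0 = xi Z 0 -> eta i 0 = eta Z 0.
Proof.
move=> walks D0 i /walks[w [iw <- wxi]]; apply: walk_const iw _ => j sj tj.
by apply: D0; rewrite mul_Dmx !wxi // subrr.
Qed.

(** * Admissibility and minimality of the sign set *)

Lemma sign_set_admissible (R : realType) (n m d : nat) (G : spring_graph n m)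
    (Dperp : 'M[R]_(m, d)) (Phi Psi : 'I_n) (p : seq (bool * 'I_m))
    (xi : 'cV[R]_n) :
  Dperp^T *m Dmx G R = 0 -> spring_path G Phi Psi p -> xi Phi 0 < xi Psi 0 ->
  admissible (incidence R p) Dperp (sign_set (Dmx G R *m xi)).
Proof.
move=> DpD p_path xi_lt; apply/admissibleP.
exists (fun q => `|(Dmx G R *m xi) q.2 0|); rewrite signed_sum_sign_set; split=> //.
  by rewrite (mul_incidence_Dmx _ p_path) subr_gt0.
by rewrite mulmxA DpD mul0mx.
Qed.

Lemma admissible_sub_sign_set (R : realType) (n m : nat) (G : spring_graph n m)
    (Dperp : 'M[R]_(m, m.+1 - n)) (Phi Psi : 'I_n) (p : seq (bool * 'I_m))
    (xi : 'cV[R]_n) (J : {set bool * 'I_m}) :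
  connected_graph G -> Dperp^T *m Dmx G R = 0 ->
  \rank Dperp = (m.+1 - n)%N -> spring_path G Phi Psi p ->
  level_walks G Phi xi -> level_walks G Psi xi ->
  (forall i, xi i 0 = xi Phi 0 \/ xi i 0 = xi Psi 0) ->
  J \subset sign_set (Dmx G R *m xi) ->
  admissible (incidence R p) Dperp J -> J = sign_set (Dmx G R *m xi).
Proof.
move=> Gconn DpD rkDp p_path walkPhi walkPsi xi_two JS /admissibleP[c [_]].
have sum0 j : (forall b, (b, j) \notin J) -> signed_sum J c j 0 = 0.
  exact: signed_sum_notin.
(* The combination becomes a vector [v] vanishing on springs absent from [J]; the kernel condition
   writes it as [D eta]. *)
move: (signed_sum J c) sum0 => v v0 v_gt0 /(ker_Dperp Gconn DpD rkDp)[eta v_eta].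
move: v0 v_gt0; rewrite {v}v_eta (mul_incidence_Dmx _ p_path) => v0 eta_lt.
have D0 j : (Dmx G R *m xi) j 0 = 0 -> (Dmx G R *m eta) j 0 = 0.
  move=> xij0; apply: v0 => b; apply/negP => /(subsetP JS).
  by rewrite in_sign_set xij0 eqxx.
have etaPhi := level_walks_const walkPhi D0.
have etaPsi := level_walks_const walkPsi D0.
apply/eqP; rewrite eqEsubset JS; apply/subsetP => -[b j] bjS.
(* The sign set fixes the sign over [j], so if [(b, j)] is missing from [J], no pair over [j] is in
   [J] and [D eta] vanishes there. *)
apply: contraTT eta_lt => bjJ; move: (bjS); rewrite in_sign_set => /andP[xij_neq0 bE].
have : (Dmx G R *m eta) j 0 = 0.
  apply: v0 => b'; apply: contra bjJ => b'jJ.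
  have := subsetP JS _ b'jJ; rewrite in_sign_set => /andP[_ /eqP b'E].
  by rewrite (eqP bE) -b'E.
move: xij_neq0; rewrite !mul_Dmx subr_eq0 => xij_neq.
(* Only the cases where [j] joins the two level sets remain; there, equal values of [eta] at the
   ends of [j] give [eta Phi = eta Psi]. *)
case: (xi_two (terminus G j)) (xi_two (source G j)) => tE [] sE;
  move: xij_neq; rewrite tE sE ?eqxx // => _.
  by rewrite (etaPhi _ tE) (etaPsi _ sE) => /subr0_eq->; rewrite subrr ltxx.
by rewrite (etaPsi _ tE) (etaPhi _ sE) => ->; rewrite ltxx.
Qed.

Theorem theorem3p5 (R : realType) (n m : nat) (G : spring_graph n m)
    (Gconn : connected_graph G)
    (Dperp : 'M[R]_(m, m.+1 - n))
    (Dperp_orth : Dperp^T *m Dmx G R = 0)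
    (Dperp_rank : \rank Dperp = (m.+1 - n)%N)
    (Phi Psi : 'I_n) (PhiPsi : Phi <> Psi)
    (p : seq (bool * 'I_m)) (p_path : spring_path G Phi Psi p)
    (xi : 'cV[R]_n)
    (xi_Phi : forall i, i <> Phi -> xi i 0 <> xi Phi 0)
    (xi_Psi : forall i, i <> Psi -> xi i 0 <> xi Psi 0)
    (xi_lt : xi Phi 0 < xi Psi 0)
    (s : seq 'cV[R]_n) (s_transf : path (transformation G Phi Psi) xi s)
    (xi' : 'cV[R]_n) (xi'_last : xi' = last xi s)
    (xi'_two : forall i, xi' i 0 = xi' Phi 0 \/ xi' i 0 = xi' Psi 0) :
  (forall i : 'I_n,
     (xi' i 0 = xi' Phi 0 -> i <> Phi ->
        exists w : seq 'I_n,
          [/\ path (adjacent G) i w, last i w = Phi &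
              forall j, j \in i :: w -> xi' j 0 = xi' Phi 0]) /\
     (xi' i 0 = xi' Psi 0 -> i <> Psi ->
        exists w : seq 'I_n,
          [/\ path (adjacent G) i w, last i w = Psi &
              forall j, j \in i :: w -> xi' j 0 = xi' Psi 0])) /\
  (admissible (incidence R p) Dperp (sign_set (Dmx G R *m xi')) /\
   irreducible (incidence R p) Dperp (sign_set (Dmx G R *m xi'))).
Proof.
have walks Z : Z \in [:: Phi; Psi] ->
    xi' Z 0 = xi Z 0 /\ level_walks G Z xi'.
  move=> ZPP; rewrite xi'_last; apply: (level_walks_last ZPP s_transf) => i iZ.
  (* Initially the level set of [Z] is [Z] alone, by the distinctness assumed of [xi], so the empty
     walk suffices. *)
  have <- : i = Z.
    move: ZPP iZ; rewrite !inE => /orP[]/eqP-> iZ; apply/eqP; apply: contra_eqT iZ.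
      by move=> /eqP/xi_Phi/eqP.
    by move=> /eqP/xi_Psi/eqP.
  by exists [::]; split=> // j; rewrite inE => /eqP->.
have [xi'Phi walkPhi] := walks Phi (mem_head _ _).
have [xi'Psi walkPsi] := walks Psi (mem_last Phi [:: Psi]).
have xi'_lt : xi' Phi 0 < xi' Psi 0 by rewrite xi'Phi xi'Psi.
have adm := sign_set_admissible Dperp_orth p_path xi'_lt.
split; first by move=> i; split=> [/walkPhi|/walkPsi].
split; [exact: adm | split; first exact: adm] => J JS J_neq admJ; apply: J_neq.
exact: (admissible_sub_sign_set Gconn Dperp_orth Dperp_rank p_path
  walkPhi walkPsi xi'_two JS admJ).
Qed.
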